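(* There exists a constant $c_P>1$ such that $$\int_0^1(7-3y)y(1-y)^2\Phi_y^2\,dy+\frac{10}{3}\left(\int_0^1(3-2y)\Phi\,dy\right)^2\ge c_P\int_0^1(1-y)(12-y)\Phi^2\,dy$$ for any $\Phi\in H^1_{\mathrm{loc}}(0,1)\cap L^1(0,1)$ satisfying $$\int_0^1(7-3y)y(1-y)^2\Phi_y^2\,dy<\infty,\qquad \int_0^1(1-y)(12-y)\Phi^2\,dy<\infty.$$
   Context: $\Phi$ is real-valued and $\Phi_y$ is its weak derivative on $(0,1)$. *)

(* Defs.v *)
From mathcomp Require Import all_boot all_order all_algebra.
From mathcomp Require Import all_classical all_reals all_analysis.

Set Implicit Arguments.
Unset Strict Implicit.
Unset Printing Implicit Defensive.

Import Order.TTheory GRing.Theory Num.Theory.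
Import numFieldNormedType.Exports.

Local Open Scope classical_set_scope.
Local Open Scope ring_scope.

(* Functions on an open set D are represented by total functions on R, whose
   values outside D are irrelevant; measurability is Borel measurability, so
   classes of functions modulo null sets are represented by Borel functions. *)

(* phi \in C_c^\infty(D) *)
Definition test_function (R : realType) (D : set R) (phi : R -> R) : Prop :=
  [/\ forall (n : nat) (x : R), derivable (derive1n n phi) x 1,
      compact (closure [set x | phi x != 0]) &
      closure [set x | phi x != 0] `<=` D].

Definition weak_derivative (R : realType) (D : set R) (f g : R -> R) : Prop :=
  [/\ locally_integrable D f, locally_integrable D g &
      forall phi : R -> R, test_function D phi ->
        \int[@lebesgue_measure R]_(x in D) (f x * derive1 phi x) =
        - \int[@lebesgue_measure R]_(x in D) (g x * phi x)].

Definition L2loc (R : realType) (D : set R) (f : R -> R) : Prop :=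
  measurable_fun D f /\ locally_integrable D (fun x => f x ^+ 2).

Definition H1loc (R : realType) (D : set R) (f : R -> R) : Prop :=
  L2loc D f /\ exists g : R -> R, weak_derivative D f g /\ L2loc D g.

(* Main.v *)
Require Import Defs.
From Stdlib Require Import ZArith.
From mathcomp Require Import all_boot all_order all_algebra.
From mathcomp Require Import all_classical all_reals all_analysis.
From mathcomp Require Import measurable_realfun ssrZ ring lra.

Import Order.TTheory GRing.Theory Num.Theory.
Import numFieldNormedType.Exports.

Local Open Scope classical_set_scope.
Local Open Scope ring_scope.

(* Put p = (7 - 3 y) y (1 - y)^2, w = (1 - y) (12 - y), h = 3 - 2 y and
   F(y) = \int_0^y h Phi. There are explicit polynomials a, b, d such that, with
   S = a Phi^2 + 2 b Phi F + d F^2, the quadratic form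
   300 p Phi_y^2 - 301 w Phi^2 + S' in (Phi_y, Phi, F) is nonnegative at every
   y in [0, 1] (here F' = h Phi). Integrating over [s, t] bounds
   \int_s^t (300 p Phi_y^2 - 301 w Phi^2) from below by S(s) - S(t). Since
   a > 0 near 0 and a < 0 near 1, completing the square removes the uncontrolled
   boundary values of Phi: S(s) >= - C F(s)^2 tends to 0, while
   S(t) <= (d(t) + C (1 - t)) F(t)^2 tends to d(1) F(1)^2 = 1000 F(1)^2, which
   gives the inequality with c_P = 301 / 300.

   The integration is legitimate because, between Lebesgue points of Phi, the
   weak derivative satisfies the fundamental theorem of calculus. *)

Delimit Scope Z_scope with coqZ.

(** * Nonnegativity of integer polynomials on [0, 1] by computation *)

Fixpoint zp_add (p q : seq Z) : seq Z :=
  match p, q with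
  | [::], _ => q
  | _, [::] => p
  | a :: p', b :: q' => Z.add a b :: zp_add p' q'
  end.

Definition zp_scale (c : Z) (p : seq Z) : seq Z := [seq Z.mul c x | x <- p].

Fixpoint zp_mul (p q : seq Z) : seq Z :=
  if p is a :: p' then zp_add (zp_scale a q) (Z0 :: zp_mul p' q) else [::].

Fixpoint zp_deriv (p : seq Z) : seq Z :=
  if p is _ :: p' then zp_add p' (Z0 :: zp_deriv p') else [::].

(* N ^ (size p) * p ((k + z) / N) as a polynomial in z, that is, p restricted to
   [k / N, (k + 1) / N] up to a positive factor. *)
Fixpoint zp_rescale (k N : Z) (p : seq Z) : seq Z :=
  if p is c :: p' then
    zp_add [:: Z.mul c (Z.pow N (Z.of_nat (size p)))]
           (zp_mul [:: k; Z.one] (zp_rescale k N p'))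
  else [::].

(* By Abel summation, a polynomial whose coefficients have nonnegative partial
   sums is nonnegative on [0, 1]. *)
Fixpoint zp_prefix_ge0 (s : Z) (p : seq Z) : bool :=
  if p is c :: p' then Z.leb Z0 (Z.add s c) && zp_prefix_ge0 (Z.add s c) p'
  else true.

(** The prefix-sum criterion is crude on all of [0, 1] but becomes sharp on short intervals; it is
    therefore applied to [m] consecutive cells of width 1 / N, starting at k / N. *)
Fixpoint zp_check (k : Z) (m : nat) (N : Z) (p : seq Z) : bool :=
  if m is m'.+1 then
    zp_prefix_ge0 Z0 (zp_rescale k N p) && zp_check (Z.add k Z.one) m' N p
  else true.

(** Coefficients, listed from the lowest degree, stay in binary integers so that all sign checks run
    by [vm_compute]; [zr] carries the result to the reals. *)
Definition zr (R : realType) (z : Z) : R := (int_of_Z z)%:~R.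

Definition zp_eval (R : realType) (p : seq Z) (y : R) : R :=
  foldr (fun c r => zr R c + y * r) 0 p.

Section integer_polynomials.
Context {R : realType}.
Implicit Types (p q : seq Z) (x y z : R).

Lemma zrD a b : zr R (Z.add a b) = zr R a + zr R b.
Proof.
by rewrite /zr -[Z.add a b]/(a + b) rmorphD /= intrD.
Qed.

Lemma zrM a b : zr R (Z.mul a b) = zr R a * zr R b.
Proof. by rewrite /zr -[Z.mul a b]/(a * b) rmorphM /= intrM. Qed.

Lemma zr0 : zr R Z0 = 0. Proof. by []. Qed.
Lemma zr1 : zr R Z.one = 1. Proof. by []. Qed.

Lemma zr_nat (n : nat) : zr R (Z.of_nat n) = n%:R.
Proof.
by rewrite /zr pmulrn; congr (_%:~R); case: n => //= n; rewrite SuccNat2Pos.id_succ.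
Qed.

Lemma zrN (z : Z) : zr R (Z.opp z) = - zr R z.
Proof. by rewrite /zr -mulrNz -[Z.opp z]/(- z) raddfN. Qed.

(** Turns images of integer literals into numerals that [ring] and [lra] recognise; the premise
    holds by computation. *)
Lemma zr_lit (n : nat) (z : Z) : Z.of_nat n = z -> zr R z = n%:R.
Proof. by move<-; exact: zr_nat. Qed.

Lemma zr_Nlit (n : nat) (z : Z) : Z.opp (Z.of_nat n) = z -> zr R z = - n%:R.
Proof. by move<-; rewrite zrN zr_nat. Qed.

Lemma zrX a n : zr R (Z.pow a (Z.of_nat n)) = zr R a ^+ n.
Proof.
elim: n => [|n IH]; first by rewrite expr0.
by rewrite Nat2Z.inj_succ Z.pow_succ_r ?zrM ?IH ?exprS//; exact: Nat2Z.is_nonneg.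
Qed.

Lemma zr_ge0 a : Z.leb Z0 a -> 0 <= zr R a.
Proof. by case: a => [|a|a] // _; rewrite /zr ler0z. Qed.

Lemma zp_eval_nil y : zp_eval R [::] y = 0. Proof. by []. Qed.

Lemma zp_eval_cons c p y : zp_eval R (c :: p) y = zr R c + y * zp_eval R p y.
Proof. by []. Qed.

Lemma zp_eval_add p q y : zp_eval R (zp_add p q) y = zp_eval R p y + zp_eval R q y.
Proof.
elim: p q => [q|a p IH [|b q]] /=; rewrite ?add0r ?addr0//.
by rewrite IH zrD; ring.
Qed.

Lemma zp_eval_scale c p y : zp_eval R (zp_scale c p) y = zr R c * zp_eval R p y.
Proof.
elim: p => [|a p IH] /=; first by rewrite mulr0.
by rewrite IH zrM; ring.
Qed.

Lemma zp_eval_mul p q y : zp_eval R (zp_mul p q) y = zp_eval R p y * zp_eval R q y.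
Proof.
elim: p => [|a p IH] /=; first by rewrite mul0r.
by rewrite zp_eval_add zp_eval_scale /= IH zr0; ring.
Qed.

Lemma zp_eval_derive p y :
  is_derive y 1 (zp_eval R p) (zp_eval R (zp_deriv p) y).
Proof.
elim: p => [|a p IH] /=; first exact: is_derive_cst.
rewrite zp_eval_add /= zr0 add0r.
have -> : zp_eval R (a :: p) = cst (zr R a) + (id * zp_eval R p) by [].
apply: is_derive_eq; rewrite add0r /GRing.scale /= mulr1; ring.
Qed.

Lemma zp_eval_rescale k N p z : zr R N != 0 ->
  zp_eval R (zp_rescale k N p) z
  = zr R N ^+ size p * zp_eval R p ((zr R k + z) / zr R N).
Proof.
move=> N0; elim: p => [|c p IH]; first by rewrite /= mulr0.
rewrite -[zp_rescale k N (c :: p)]/(zp_add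
  [:: Z.mul c (Z.pow N (Z.of_nat (size p).+1))]
  (zp_mul [:: k; Z.one] (zp_rescale k N p))).
rewrite zp_eval_add zp_eval_mul IH !zp_eval_cons !zp_eval_nil zrM zrX zr1.
by rewrite [size (_ :: _)]/= !exprS; field.
Qed.

Lemma zp_prefix_ge0P s p y : 0 <= y <= 1 -> Z.leb Z0 s -> zp_prefix_ge0 s p ->
  0 <= zr R s + zp_eval R p y.
Proof.
move=> /andP[y0 y1]; elim: p s => [s s0 _|c p IH s s0 /= /andP[sc0 pre]].
  by rewrite addr0 zr_ge0.
have := IH _ sc0 pre; have := zr_ge0 _ sc0; rewrite zrD => h1 h2.
(* With P the value of the tail, s + c + y P = (1 - y) (s + c) + y (s + c + P), a convex combination
   of the quantities in [h1] and [h2]. *)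
nra.
Qed.

Lemma zr_gt0 a : Z.ltb Z0 a -> 0 < zr R a.
Proof.
by case: a => // a _; rewrite /zr ltr0z ltz_nat; apply/ssrnat.ltP/Pos2Nat.is_pos.
Qed.

(** Either y lies in the first cell, or the remaining cells cover it. The hypothesis [0 < m%:R]
    excludes an empty list of cells, whose check is vacuous. *)
Lemma zp_checkP k m N p y : Z.ltb Z0 N -> zp_check k m N p ->
  zr R k <= zr R N * y <= zr R k + m%:R -> 0 < m%:R :> R -> 0 <= zp_eval R p y.
Proof.
move=> /zr_gt0 N0; elim: m k => [|m IH] k; first by rewrite ltxx.
move=> /= /andP[h1 h2] /andP[ky yk] _.
have [yk1|yk1] := leP (zr R N * y) (zr R k + 1).
  have z01 : 0 <= zr R N * y - zr R k <= 1 by lra.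
  have := zp_prefix_ge0P Z0 _ _ z01 isT h1.
  rewrite zr0 add0r zp_eval_rescale ?gt_eqF// pmulr_rge0 ?exprn_gt0//.
  by rewrite addrC subrK mulrAC mulfV ?mul1r ?gt_eqF.
apply: (IH (Z.add k Z.one)) => //.
  by rewrite zrD zr1 ltW//= -addrA nat1r.
rewrite ltr0n lt0n; apply/eqP => m0; subst m.
by move: yk yk1; lra.
Qed.

Lemma zp_check01 (N : nat) p y : (0 < N)%N -> zp_check Z0 N (Z.of_nat N) p ->
  0 <= y <= 1 -> 0 <= zp_eval R p y.
Proof.
move=> N0 h y01.
have N0' : 0 < N%:R :> R by rewrite ltr0n.
apply: (zp_checkP Z0 N (Z.of_nat N)) => //.
  by apply/Z.ltb_spec0/(inj_lt 0); apply/ssrnat.ltP.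
by rewrite zr_nat zr0; nra.
Qed.

End integer_polynomials.

(** * The quadratic form certificate *)

(* Found numerically: for a fixed constant, nonnegativity of the quadratic form is
   a linear matrix inequality in (cert_A, cert_B, cert_D). *)
Definition cert_A : seq Z := [:: 122; -1087; 1748; -784]%coqZ.
Definition cert_B : seq Z := [:: 398; -742; 252; 120]%coqZ.
Definition cert_D : seq Z := [:: 159; -300; 71; 159]%coqZ.

(** The factor 30 y (1 - y) in a and b matches the degeneracy of p: (a u + b F)^2 / (300 p) = 3 y (A
    u + B F)^2 / (7 - 3 y), with no singularity on [0, 1]. *)
Definition cert_a : seq Z := zp_mul [:: 0; 30; -30]%coqZ cert_A.
Definition cert_b : seq Z := zp_mul [:: 0; 30; -30]%coqZ cert_B.
(** Written as 1000 - 30 (1 - y) D to force d(1) = 1000 = 300 * 10 / 3, the weight of the squared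
    integral in the inequality multiplied by 300. *)
Definition cert_d : seq Z :=
  zp_add [:: 1000]%coqZ (zp_mul [:: -30; 30]%coqZ cert_D).

(* Eliminating (1 - y) * Phi_y by completing the square, which needs a
   multiplication by 7 - 3 y, leaves the form E11 u^2 + 2 E12 u F + E22 F^2. *)
Definition cert_p : seq Z := [:: 7; -3]%coqZ.
Definition cert_h : seq Z := [:: 3; -2]%coqZ.
Definition cert_w : seq Z := zp_mul [:: 1; -1]%coqZ [:: 12; -1]%coqZ.

Definition cert_E11 : seq Z :=
  zp_add
    (zp_mul cert_p
      (zp_add (zp_add (zp_deriv cert_a) (zp_scale (-301)%coqZ cert_w))
              (zp_scale 2%coqZ (zp_mul cert_h cert_b))))
    (zp_mul [:: 0; -3]%coqZ (zp_mul cert_A cert_A)).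

Definition cert_E12 : seq Z :=
  zp_add
    (zp_mul cert_p (zp_add (zp_deriv cert_b) (zp_mul cert_h cert_d)))
    (zp_mul [:: 0; -3]%coqZ (zp_mul cert_A cert_B)).

Definition cert_E22 : seq Z :=
  zp_add (zp_mul cert_p (zp_deriv cert_d))
    (zp_mul [:: 0; -3]%coqZ (zp_mul cert_B cert_B)).

Definition cert_det : seq Z :=
  zp_add (zp_mul cert_E11 cert_E22)
    (zp_scale (-1)%coqZ (zp_mul cert_E12 cert_E12)).

Section certificate.
Context {R : realType}.
Local Notation a := (zp_eval R cert_a).
Local Notation b := (zp_eval R cert_b).
Local Notation d := (zp_eval R cert_d).
Local Notation a' := (zp_eval R (zp_deriv cert_a)).
Local Notation b' := (zp_eval R (zp_deriv cert_b)).
Local Notation d' := (zp_eval R (zp_deriv cert_d)).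

Lemma psd2_ge0 (e11 e12 e22 u v : R) : 0 < e11 -> 0 <= e11 * e22 - e12 ^+ 2 ->
  0 <= e11 * u ^+ 2 + 2 * e12 * u * v + e22 * v ^+ 2.
Proof.
move=> e110 det0; rewrite -(pmulr_rge0 _ e110).
have -> : e11 * (e11 * u ^+ 2 + 2 * e12 * u * v + e22 * v ^+ 2)
  = (e11 * u + e12 * v) ^+ 2 + (e11 * e22 - e12 ^+ 2) * v ^+ 2 by ring.
by apply: addr_ge0; [exact: sqr_ge0|apply: mulr_ge0 => //; exact: sqr_ge0].
Qed.

(** The cell check yields only weak inequalities, so strictness comes from checking E11 - 1. *)
Lemma cert_E11_gt0 y : 0 <= y <= 1 -> 0 < zp_eval R cert_E11 y.
Proof.
move=> y01; have : 0 <= zp_eval R (zp_add [:: (-1)%coqZ] cert_E11) y.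
  by apply: (zp_check01 100) => //; vm_compute.
by rewrite zp_eval_add zp_eval_cons -[zr R _]/(-1) zp_eval_nil; lra.
Qed.

Lemma cert_det_ge0 y : 0 <= y <= 1 ->
  0 <= zp_eval R cert_E11 y * zp_eval R cert_E22 y - zp_eval R cert_E12 y ^+ 2.
Proof.
move=> y01; have : 0 <= zp_eval R cert_det y.
  by apply: (zp_check01 30) => //; vm_compute.
by rewrite /cert_det zp_eval_add zp_eval_scale !zp_eval_mul -expr2 mulN1r.
Qed.

(** The last bracket is the derivative of a u^2 + 2 b u F + d F^2 under u' = g and F' = (3 - 2 y) u.
    Multiplied by 7 - 3 y, the whole expression is 3 y times a square containing g, plus the
    semidefinite form in u and F with entries E11, E12, E22. *)
Lemma cert_ge0 (y u g F : R) : 0 <= y <= 1 ->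
  0 <= 300 * ((7 - 3 * y) * y * (1 - y) ^+ 2 * g ^+ 2)
       - 301 * ((1 - y) * (12 - y) * u ^+ 2)
       + (a' y * u ^+ 2 + 2 * a y * u * g
          + 2 * (b' y * u * F + b y * (g * F + u * ((3 - 2 * y) * u)))
          + d' y * F ^+ 2 + 2 * d y * F * ((3 - 2 * y) * u)).
Proof.
move=> y01; have m0 : 0 < 7 - 3 * y :> R by lra.
rewrite -(pmulr_rge0 _ m0).
have := psd2_ge0 _ (zp_eval R cert_E12 y) (zp_eval R cert_E22 y) u F
  (cert_E11_gt0 _ y01) (cert_det_ge0 _ y01).
have : 0 <= 3 * y * (10 * ((7 - 3 * y) * (1 - y) * g)
  + (zp_eval R cert_A y * u + zp_eval R cert_B y * F)) ^+ 2.
  by rewrite mulr_ge0 ?sqr_ge0// mulr_ge0//; case/andP: y01.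
move=> h1 h2; have := addr_ge0 h1 h2; congr (_ <= _).
rewrite /cert_E11 /cert_E12 /cert_E22.
rewrite !(zp_eval_add, zp_eval_mul, zp_eval_scale, zp_eval_cons, zp_eval_nil).
rewrite !(zr_lit 0 0%coqZ, zr_lit 1 1%coqZ, zr_lit 2 2%coqZ, zr_lit 3 3%coqZ,
  zr_lit 7 7%coqZ, zr_lit 12 12%coqZ, zr_lit 30 30%coqZ, zr_Nlit 1 (-1)%coqZ,
  zr_Nlit 2 (-2)%coqZ, zr_Nlit 3 (-3)%coqZ, zr_Nlit 30 (-30)%coqZ,
  zr_Nlit 301 (-301)%coqZ) //.
by ring.
Qed.

Lemma cert_d1 : d 1 = 1000.
Proof.
rewrite /cert_d zp_eval_add zp_eval_mul !(zp_eval_cons, zp_eval_nil).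
by rewrite (zr_lit 1000 1000%coqZ erefl) (zr_lit 30 30%coqZ erefl)
  (zr_Nlit 30 (-30)%coqZ erefl); ring.
Qed.

Lemma cert_ab y : (a y = 30 * y * (1 - y) * zp_eval R cert_A y) *
  (b y = 30 * y * (1 - y) * zp_eval R cert_B y).
Proof.
rewrite /cert_a /cert_b !zp_eval_mul !(zp_eval_cons, zp_eval_nil).
rewrite !(zr_lit 0 0%coqZ, zr_lit 30 30%coqZ, zr_Nlit 30 (-30)%coqZ) //.
by split; ring.
Qed.

(** Here A <= -1/2 and B^2 <= 40^2, so 30 t (1 - t) (A u^2 + 2 B u F) is at most its maximum over u
    with A replaced by -1/2, namely 60 t (1 - t) B^2 F^2 <= 96000 t (1 - t) F^2. *)
Lemma cert_right (t u F : R) : 99 / 100 <= t <= 1 ->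
  a t * u ^+ 2 + 2 * b t * u * F + d t * F ^+ 2
  <= (d t + 100 * 1000 * (1 - t)) * F ^+ 2.
Proof.
move=> /andP[t99 t1].
have tZ : zr R 99%coqZ <= zr R 100%coqZ * t <= zr R 99%coqZ + 1%:R.
  by rewrite (zr_lit 99 99%coqZ erefl) (zr_lit 100 100%coqZ erefl); lra.
have {tZ} [hA hB] : 0 <= -1 - 2 * zp_eval R cert_A t /\
    0 <= 40 * 40 - zp_eval R cert_B t * zp_eval R cert_B t.
  split.
    have : 0 <= zp_eval R (zp_add [:: (-1)%coqZ] (zp_scale (-2)%coqZ cert_A)) t.
      by apply: (zp_checkP 99%coqZ 1 100%coqZ) => //; vm_compute.
    rewrite zp_eval_add zp_eval_scale zp_eval_cons zp_eval_nil mulr0 addr0.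
    by rewrite (zr_Nlit 1 (-1)%coqZ erefl) (zr_Nlit 2 (-2)%coqZ erefl) mulNr.
  have : 0 <= zp_eval R (zp_add [:: (40 * 40)%coqZ]
      (zp_scale (-1)%coqZ (zp_mul cert_B cert_B))) t.
    by apply: (zp_checkP 99%coqZ 1 100%coqZ) => //; vm_compute.
  rewrite zp_eval_add zp_eval_scale zp_eval_mul zp_eval_cons zp_eval_nil mulr0.
  by rewrite addr0 zrM (zr_Nlit 1 (-1)%coqZ erefl) (zr_lit 40 40%coqZ erefl) mulN1r.
move: hA hB; rewrite !cert_ab; move: (zp_eval R cert_A t) (zp_eval R cert_B t) => A B hA hB.
have h1 : 0 <= 30 * t * (1 - t) * ((- 1 / 2 - A) * u ^+ 2 + (u - 2 * B * F) ^+ 2 / 2).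
  apply: mulr_ge0; first by apply: mulr_ge0; lra.
  by apply: addr_ge0; [apply: mulr_ge0; [lra|exact: sqr_ge0]|rewrite divr_ge0 ?sqr_ge0].
have h2 : 0 <= 30 * t * (1 - t) * (2 * (40 * 40 - B * B) * F ^+ 2).
  apply: mulr_ge0; first by apply: mulr_ge0; lra.
  by apply: mulr_ge0; [lra|exact: sqr_ge0].
have h3 : 0 <= (100 * 1000 - 96 * 1000 * t) * (1 - t) * F ^+ 2.
  by apply: mulr_ge0; [apply: mulr_ge0; lra|exact: sqr_ge0].
by move: h1 h2 h3; lra.
Qed.

(** Here A >= 100, B^2 <= 400^2 and d >= -5000. Minimising 100 u^2 + 2 B u F over u costs at most
    48000 s (1 - s) F^2, which together with d stays above -50000 F^2. *)
Lemma cert_left (s u F : R) : 0 <= s <= 1 / 100 ->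
  - (50 * 1000) * F ^+ 2 <= a s * u ^+ 2 + 2 * b s * u * F + d s * F ^+ 2.
Proof.
move=> /andP[s0 s1].
have sZ : zr R 0%coqZ <= zr R 100%coqZ * s <= zr R 0%coqZ + 1%:R.
  by rewrite (zr_lit 0 0%coqZ erefl) (zr_lit 100 100%coqZ erefl); lra.
have {sZ} [hA hB hd] : [/\ 0 <= -100 + zp_eval R cert_A s,
    0 <= 400 * 400 - zp_eval R cert_B s * zp_eval R cert_B s &
    0 <= 5 * 1000 + d s].
  split.
  - have : 0 <= zp_eval R (zp_add [:: (-100)%coqZ] cert_A) s.
      by apply: (zp_checkP 0%coqZ 1 100%coqZ) => //; vm_compute.
    rewrite zp_eval_add zp_eval_cons zp_eval_nil mulr0 addr0.
    by rewrite (zr_Nlit 100 (-100)%coqZ).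
  - have : 0 <= zp_eval R (zp_add [:: (400 * 400)%coqZ]
        (zp_scale (-1)%coqZ (zp_mul cert_B cert_B))) s.
      by apply: (zp_checkP 0%coqZ 1 100%coqZ) => //; vm_compute.
    rewrite zp_eval_add zp_eval_scale zp_eval_mul zp_eval_cons zp_eval_nil.
    rewrite mulr0 addr0 zrM (zr_Nlit 1 (-1)%coqZ erefl) (zr_lit 400 400%coqZ erefl).
    by rewrite mulN1r.
  - have : 0 <= zp_eval R (zp_add [:: (5 * 1000)%coqZ] cert_d) s.
      by apply: (zp_checkP 0%coqZ 1 100%coqZ) => //; vm_compute.
    rewrite zp_eval_add zp_eval_cons zp_eval_nil mulr0 addr0 zrM.
    by rewrite (zr_lit 5 5%coqZ erefl) (zr_lit 1000 1000%coqZ).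
move: hA hB hd; rewrite !cert_ab.
move: (zp_eval R cert_A s) (zp_eval R cert_B s) (d s) => A B D hA hB hd.
have h1 : 0 <= 30 * s * (1 - s) / 100 * ((A - 100) * 100 * u ^+ 2 + (100 * u + B * F) ^+ 2).
  apply: mulr_ge0; first by apply: mulr_ge0; [apply: mulr_ge0; lra|lra].
  by apply: addr_ge0; [apply: mulr_ge0; [lra|exact: sqr_ge0]|exact: sqr_ge0].
have h2 : 0 <= 30 * s * (1 - s) / 100 * ((400 * 400 - B * B) * F ^+ 2).
  apply: mulr_ge0; first by apply: mulr_ge0; [apply: mulr_ge0; lra|lra].
  by apply: mulr_ge0; [lra|exact: sqr_ge0].
have h3 : 0 <= (D + 50 * 1000 - 48 * 1000 * s * (1 - s)) * F ^+ 2.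
  apply: mulr_ge0; last exact: sqr_ge0.
  have : 0 <= s * s by exact: mulr_ge0.
  lra.
by move: h1 h2 h3; lra.
Qed.

End certificate.

(** * A smooth step function *)

(** Carrying the successive derivatives as witnesses makes closure under sums, products and inverses
    a plain induction on n; [diff_upto_derive1n] returns to the iterated [derive1n] required of test
    functions. *)
Fixpoint diff_upto (R : realType) (n : nat) (f : R -> R) : Prop :=
  if n is n'.+1 then
    exists2 f' : R -> R, (forall x : R, is_derive x (1 : R) f (f' x)) & diff_upto R n' f'
  else True.

Section smooth_step.
Context {R : realType}.
Implicit Types (f g : R -> R) (x : R).

Lemma is_derive_continuous f f' :
  (forall x, is_derive x (1 : R) f (f' x)) -> continuous f.
Proof.
move=> df x; apply/differentiable_continuous/derivable1_diffP.
by have [] := df x.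
Qed.

Lemma continuous_affine_comp f (c a : R) : continuous f ->
  continuous (fun x => f (c * (x - a))).
Proof.
move=> cf x; apply: (@continuous_comp _ _ _ (fun z => c * (z - a)) f).
  by apply: cvgM; [exact: cvg_cst|apply: cvgB; [exact: cvg_id|exact: cvg_cst]].
exact: cf.
Qed.

Lemma diff_uptoW n f : diff_upto R n.+1 f -> diff_upto R n f.
Proof.
elim: n f => // n IH f [f' df f'n]; exists f' => //; exact: IH.
Qed.

Lemma diff_upto_derive1n f : (forall n, diff_upto R n f) ->
  forall n x, derivable (derive1n n f) x 1.
Proof.
move=> fn n; move: (fn n.+1); elim: n f {fn} => [|n IH] f [f' df f'n] x.
  by rewrite derive1n0; exact: ex_derive.
rewrite derive1Sn; suff -> : derive1 f = f' by exact: IH.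
by apply/funext => z; rewrite derive1E; exact: derive_val.
Qed.

Lemma diff_upto_cst n (c : R) : diff_upto R n (cst c).
Proof.
elim: n c => // n IH c; exists (cst 0) => [x|]; [exact: is_derive_cst|exact: IH].
Qed.

Lemma diff_uptoD n f g :
  diff_upto R n f -> diff_upto R n g -> diff_upto R n (f + g).
Proof.
elim: n f g => // n IH f g [f' df f'n] [g' dg g'n].
by exists (f' + g') => [x|]; [exact: is_deriveD|exact: IH].
Qed.

Lemma diff_uptoN n f : diff_upto R n f -> diff_upto R n (- f).
Proof.
elim: n f => // n IH f [f' df f'n].
by exists (- f') => [x|]; [exact: is_deriveN|exact: IH].
Qed.

Lemma diff_uptoM n f g :
  diff_upto R n f -> diff_upto R n g -> diff_upto R n (f * g).
Proof.
elim: n f g => // n IH f g fn1 gn1.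
move: (fn1) (gn1) => [f' df f'n] [g' dg g'n].
exists (f * g' + g * f') => [x|]; first exact: is_deriveM.
by apply: diff_uptoD; apply: IH => //; exact: diff_uptoW.
Qed.

Lemma diff_uptoV n f : (forall x, f x != 0) ->
  diff_upto R n f -> diff_upto R n (fun x => (f x)^-1).
Proof.
move=> f0; elim: n => // n IH fn1; move: (fn1) => [f' df f'n].
exists (- ((fun x => (f x)^-1) * (fun x => (f x)^-1) * f')) => [x|].
  apply: (is_derive_eq (is_deriveV (f0 x) (df x))).
  by rewrite /GRing.scale /= mulNr expr2 invfM.
apply/diff_uptoN/diff_uptoM => //.
by apply: diff_uptoM; apply: IH; exact: diff_uptoW.
Qed.

Lemma diff_upto_affine n f (a b : R) :
  diff_upto R n f -> diff_upto R n (fun x => f (a * x + b)).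
Proof.
elim: n f => // n IH f [f' df f'n].
exists (cst a * (fun x => f' (a * x + b))) => [x|].
  have -> : (fun x => f (a * x + b)) = f \o (cst a * id + cst b) by [].
  apply: is_derive_eq; rewrite addr0 scaler0 addr0 /GRing.scale /= mulr1.
  by rewrite mulrC.
by apply: diff_uptoM; [exact: diff_upto_cst|exact: IH].
Qed.

(* The family is closed under differentiation, see flat_derive. *)
Definition flat (k : nat) (x : R) : R :=
  if 0 < x then x^-1 ^+ k * expR (- x^-1) else 0.

Lemma flat_ge0 k x : 0 <= flat k x.
Proof.
by rewrite /flat; case: ifP => // x0; rewrite mulr_ge0 ?expR_ge0 ?exprn_ge0 ?invr_ge0 ?ltW.
Qed.

Lemma flat_gt0 k x : 0 < x -> 0 < flat k x.
Proof. by move=> x0; rewrite /flat x0 mulr_gt0 ?expR_gt0 ?exprn_gt0 ?invr_gt0. Qed.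

Lemma flat_le0 k x : x <= 0 -> flat k x = 0.
Proof. by move=> x0; rewrite /flat ltNge x0. Qed.

(** The exponential series gives e^(1/x) >= x^-(k+1) / (k+1)! for x > 0. This linear bound supplies
    continuity of every [flat k] at 0. *)
Lemma flat_le k x : flat k x <= (k.+1)`!%:R * `|x|.
Proof.
rewrite /flat; case: ifP => [x0|_]; last by rewrite mulr_ge0.
have f0 : 0 < k.+1`!%:R :> R by rewrite ltr0n fact_gt0.
have := @expR_ge1Dxn R x^-1 k; rewrite invr_ge0 (ltW x0) => /(_ isT) h.
rewrite expRN ler_pdivrMr ?expR_gt0// gtr0_norm//.
apply: (@le_trans _ _ ((k.+1`!%:R * x) * (x^-1 ^+ k.+1 / k.+1`!%:R))).
  rewrite exprS le_eqVlt; apply/orP; left; apply/eqP; field.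
  by rewrite !gt_eqF.
rewrite ler_wpM2l ?mulr_ge0 ?(ltW x0)//.
by apply: le_trans h; rewrite lerDr.
Qed.

Lemma flat_continuous0 k : {for 0, continuous (flat k)}.
Proof.
rewrite /prop_for /continuous_at flat_le0//; apply/cvgr0Pnorm_lt => e e0.
have C0 : 0 < (k.+1)`!%:R :> R by rewrite ltr0n fact_gt0.
near=> z; rewrite ger0_norm ?flat_ge0//.
apply: le_lt_trans (flat_le _ _) _.
rewrite -ltr_pdivlMl//; near: z.
apply: (@cvgr0_norm_lt _ _ _ (nbhs (0 : R)) _ id) => //.
by rewrite mulr_gt0 ?invr_gt0.
Unshelve. all: by end_near. Qed.

Lemma flat_derive k x :
  is_derive x 1 (flat k) (flat k.+2 x - k%:R * flat k.+1 x).
Proof.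
have [x0|x0|->] := ltgtP x 0.
- rewrite !flat_le0 ?(ltW x0)// mulr0 subr0.
  apply: (near_eq_is_derive _ (is_derive_cst 0 x 1)).
  near=> z; rewrite flat_le0//; apply/ltW; near: z; exact: lt_nbhsl.
- pose e (z : R) := z^-1 ^+ k * expR (- z^-1).
  apply: (@near_eq_is_derive _ _ _ e).
    near=> z; rewrite /flat ifT//; near: z; exact: lt_nbhsr.
  have xn0 : id x != 0 by rewrite gt_eqF.
  have dinv := is_deriveV xn0 (is_derive_id x 1).
  have -> : e = (fun z => (id z)^-1) ^+ k * (expR \o (- (fun z => (id z)^-1))).
    by apply/funext => z; rewrite /e fctE /= exprfctE.
  apply: is_derive_eq; rewrite /GRing.scale /=. rewrite /flat x0.
  rewrite exprfctE -[(- _) x]/(- x^-1) -!exprVn.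
  clear e.
  by case: k => [|k] /=; rewrite ?mul0r !exprS; ring.
- rewrite !flat_le0// mulr0 subr0.
  (* Since [flat k z] equals z times [flat k.+1 z], the difference quotient at 0 is again a member
     of the family, continuous at 0 with value 0. *)
  apply/is_derive1_caratheodory; exists (flat k.+1); split.
  + move=> z; rewrite [flat k 0]flat_le0// !subr0 /flat; case: ifP => z0.
      by rewrite exprS; field; rewrite gt_eqF.
    by rewrite mul0r.
  + exact: flat_continuous0.
  + by rewrite flat_le0.
Unshelve. all: by end_near. Qed.

Lemma diff_upto_flat n k : diff_upto R n (flat k).
Proof.
elim: n k => // n IH k; exists (flat k.+2 - cst k%:R * flat k.+1).
  by move=> x; exact: flat_derive.
apply: diff_uptoD => //; apply/diff_uptoN/diff_uptoM => //.
exact: diff_upto_cst.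
Qed.

Lemma smooth_step_exists : exists S dS : R -> R, exists C : R,
  [/\ forall n, diff_upto R n S, forall x : R, is_derive x (1 : R) S (dS x),
      continuous dS, forall x, `|dS x| <= C &
      [/\ forall x, x <= 0 -> S x = 0, forall x, 1 <= x -> S x = 1,
          forall x, 0 <= S x <= 1 & forall x, x < 0 \/ 1 < x -> dS x = 0]].
Proof.
(* The step is f(x) / (f(x) + f(1 - x)) with f = [flat 0]; the denominator is positive because x and
   1 - x are never both nonpositive. *)
pose g x := flat 0 (-1 * x + 1); pose h := flat 0 + g.
have h0 x : 0 < h x.
  rewrite /h /g; have [x0|x0] := ltP 0 x; first by rewrite ltr_pwDl ?flat_gt0 ?flat_ge0.
  by rewrite ltr_wpDl ?flat_ge0// flat_gt0; lra.
have hn n : diff_upto R n h.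
  by apply: diff_uptoD; [|apply: diff_upto_affine]; exact: diff_upto_flat.
pose S := flat 0 * (fun x => (h x)^-1).
have Sn n : diff_upto R n S.
  apply: diff_uptoM; first exact: diff_upto_flat.
  by apply: diff_uptoV => // x; rewrite gt_eqF.
have S0 x : x <= 0 -> S x = 0.
  by move=> x0; rewrite /S -[LHS]/(flat 0 x * _) flat_le0 ?mul0r.
have S1 x : 1 <= x -> S x = 1.
  move=> x1; rewrite /S -[LHS]/(flat 0 x / (flat 0 x + g x)) /g.
  have -> : flat 0 (-1 * x + 1) = 0 by apply: flat_le0; lra.
  by rewrite addr0 mulfV// gt_eqF// flat_gt0; lra.
have [dS SdS [ddS dSddS _]] := Sn 2%N.
have cdS : continuous dS := is_derive_continuous _ _ dSddS.
have dS0 x : x < 0 \/ 1 < x -> dS x = 0.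
  move=> x01; have [_ <-] := SdS x; case: x01 => x01.
    have /near_eq_derive -> : \near x, S x = cst 0 x.
      by near=> z; rewrite S0//; apply/ltW; near: z; exact: lt_nbhsl.
    exact: derive_cst.
  have /near_eq_derive -> : \near x, S x = cst 1 x.
    by near=> z; rewrite S1//; apply/ltW; near: z; exact: lt_nbhsr.
  exact: derive_cst.
(* The continuous derivative vanishes outside [0, 1], so its maximum modulus on that interval is a
   global bound. *)
have [c _ cmax] : exists2 c, c \in `[0, 1] & forall t, t \in `[0, 1] ->
    `|dS t| <= `|dS c|.
  apply: EVT_max => //; apply: continuous_subspaceT => x.
  by apply: continuous_comp; [exact: cdS|exact: norm_continuous].
exists S, dS, `|dS c|; split => //.
  move=> x; have [x01|] := boolP (x \in `[0, 1]); first exact: cmax.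
  rewrite in_itv /= negb_and -!ltNge => /orP x01.
  by rewrite dS0 ?normr0.
split => // x; rewrite /S -[_ x]/(flat 0 x / (flat 0 x + g x)).
have := flat_ge0 0 x; have := flat_ge0 0 (-1 * x + 1) => g0 f0.
have := h0 x; rewrite -[h x]/(flat 0 x + g x) => fg0.
by apply/andP; split; [exact/divr_ge0/ltW|rewrite ler_pdivrMr ?mul1r ?lerDl].
Unshelve. all: by end_near. Qed.

End smooth_step.

(** * Weak derivatives and the fundamental theorem of calculus *)

Section weak_derivative_FTC.
Context {R : realType}.
Local Notation mu := (@lebesgue_measure R).
Implicit Types (f g h : R -> R) (D A : set (measurableTypeR R)) (x y : R).

Lemma integrable_mul_bounded D f h (M : R) : measurable D ->
  mu.-integrable D (EFin \o f) -> measurable_fun D h ->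
  (forall x, D x -> `|h x| <= M) ->
  mu.-integrable D (EFin \o (fun x => f x * h x)).
Proof.
move=> mD fi mh hM.
have := @integrableMl _ _ _ mu D mD _ h fi mh; apply.
exists M; split; first exact: num_real.
by move=> N MN x Dx; apply: le_trans (hM _ Dx) (ltW MN).
Qed.

Lemma Rintegral_support A D f : A `<=` D -> (forall x, D x -> ~ A x -> f x = 0) ->
  \int[mu]_(x in D) f x = \int[mu]_(x in A) f x.
Proof.
move=> AD f0; rewrite Rintegral_mkcond [RHS]Rintegral_mkcond; congr Rintegral.
apply/funext => x; rewrite !patchE.
have [xA|xA] := boolP (x \in A); first by rewrite ifT// inE; apply/AD/set_mem.
case: ifPn => // xD; apply: f0; first exact: set_mem.
by move=> /mem_set; apply/negP.
Qed.

(** The kernels have integral 1, live on [x, x + 1/(n+1)] and are bounded by (n+1) C. The error is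
    thus at most 4 C times the mean of |f - f x| over a ball around x shrinking to it, which
    vanishes at a Lebesgue point. The radius 2/(n+1) makes the open ball contain the closed
    support. *)
Lemma lebesgue_pt_kernel (dS S : R -> R) (C : R) f x :
  (forall z : R, is_derive z (1 : R) S (dS z)) -> continuous dS ->
  (forall z, `|dS z| <= C) -> (forall z, z < 0 \/ 1 < z -> dS z = 0) ->
  S 0 = 0 -> S 1 = 1 ->
  mu.-integrable setT (EFin \o f) -> lebesgue_pt f x ->
  \int[mu]_z (f z * (n.+1%:R * dS (n.+1%:R * (z - x)))) @[n --> \oo] --> f x.
Proof.
move=> SdS cdS dSC dS0 S0 S1 fi fx.
pose d n : R := n.+1%:R^-1.
pose k (n : nat) z : R := n.+1%:R * dS (n.+1%:R * (z - x)).
have N0 n : 0 < n.+1%:R :> R by [].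
have d0 n : 0 < d n by rewrite invr_gt0.
have ck n : continuous (k n).
  move=> z; apply: cvgM; first exact: cvg_cst.
  exact: continuous_affine_comp cdS _.
have kC n z : `|k n z| <= n.+1%:R * C.
  by rewrite normrM gtr0_norm// ler_wpM2l// ltW.
have k0 n z : ~ [set` `[x, x + d n]] z -> k n z = 0.
  rewrite /= in_itv /= => /negP; rewrite negb_and -!ltNge => /orP h.
  rewrite /k dS0 ?mulr0//; case: h => h; [left|right].
    by rewrite pmulr_rlt0// subr_lt0.
  by rewrite -ltr_pdivrMl// mulr1 ltrBrDl.
have ki n : \int[mu]_(z in `[x, x + d n]) k n z = 1.
  have xd : x < x + d n by rewrite ltrDl.
  pose G z := S (n.+1%:R * (z - x)).
  have dG z : is_derive z (1 : R) G (k n z).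
    have -> : G = S \o (cst n.+1%:R * (id - cst x)) by [].
    apply: is_derive_eq.
    by rewrite subr0 scaler0 addr0 /GRing.scale /= mulr1 mulrC.
  rewrite /Rintegral (@continuous_FTC2 _ (k n) G)//.
  - rewrite /G subrr mulr0 S0 addrAC subrr add0r mulfV ?gt_eqF//.
    by rewrite S1 -EFinB subr0.
  - exact: continuous_subspaceT.
  - have cG : continuous G := is_derive_continuous _ _ dG.
    split; first by move=> z _; have [] := dG z.
    + exact/cvg_at_right_filter/cG.
    + exact/cvg_at_left_filter/cG.
  - by move=> z _; rewrite derive1E; have [] := dG z.
have mI n : measurable ([set` `[x, x + d n]] : set (measurableTypeR R)) by exact: measurable_itv.
have fkiT n : mu.-integrable setT (EFin \o (fun z => f z * k n z)).
  apply: (integrable_mul_bounded _ _ _ (n.+1%:R * C)) => //.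
  exact: continuous_measurable_fun.
have fki n : mu.-integrable [set` `[x, x + d n]] (EFin \o (fun z => f z * k n z)).
  exact: integrableS (fkiT n).
have kii n : mu.-integrable [set` `[x, x + d n]] (EFin \o k n).
  apply: continuous_compact_integrable; first exact: segment_compact.
  exact: continuous_subspaceT.
have fkE n : \int[mu]_z (f z * k n z) - f x
    = \int[mu]_(z in `[x, x + d n]) ((f z - f x) * k n z).
  rewrite (Rintegral_support [set` `[x, x + d n]])//; last first.
    by move=> z _ /k0 ->; rewrite mulr0.
  under [RHS]eq_Rintegral do rewrite mulrBl.
  rewrite RintegralB//; first by rewrite RintegralZl// ki mulr1.
  exact: (integrableZl (mI n) (f x) (kii n)).
have bnd n : `|\int[mu]_z (f z * k n z) - f x|
    <= 4 * C * fine (davg f x (2 * d n)).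
  have dn0 : 0 <= 2 * d n by rewrite mulr_ge0// ltW.
  have C0 : 0 <= C by apply: le_trans (normr_ge0 (dS 0)) (dSC 0).
  have fcI (A : set (measurableTypeR R)) : measurable A -> (mu A < +oo)%E ->
      mu.-integrable A (EFin \o (fun z => f z - f x)).
    move=> mA Aoo; have fA : mu.-integrable A (EFin \o f) by exact: integrableS fi.
    apply: (integrableB mA fA (g := cst (f x)%:E)).
    apply: (measurable_bounded_integrable (f := cst (f x))) => //.
    by exists `|f x|; split => // M xM z _; exact: ltW.
  have mJ : measurable (ball x (2 * d n) : set (measurableTypeR R)).
    exact: measurable_ball.
  have fcJ : mu.-integrable (ball x (2 * d n)) (EFin \o (fun z => `|f z - f x|)).
    apply: integrable_norm; apply: fcI; first exact: measurable_ball.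
    by rewrite lebesgue_measure_ball// ltry.
  have IJ : [set` `[x, x + d n]] `<=` ball x (2 * d n).
    move=> z /=; rewrite in_itv /= => /andP[xz zx].
    by rewrite /ball /= ler0_norm; have := d0 n; lra.
  have -> : 4 * C * fine (davg f x (2 * d n))
      = n.+1%:R * C * \int[mu]_(z in ball x (2 * d n)) `|f z - f x|.
    rewrite /davg /iavg lebesgue_measure_ball// inver.
    have r0 : (2 * d n) *+ 2 != 0 by rewrite gt_eqF// pmulrn_lgt0// mulr_gt0.
    have fin : (\int[mu]_(z in ball x (2 * d n)) `|f z - f x|%:E)%E \is a fin_num.
      by apply: (integrable_fin_num mJ fcJ).
    rewrite (negbTE r0) fineM//=.
    rewrite /d -mulr_natr; set X := fine _; set Y := Rintegral _ _ _.
    have -> : X = Y by [].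
    by field; rewrite gt_eqF.
  rewrite fkE.
  pose I : set (measurableTypeR R) := [set` `[x, x + d n]].
  have Ioo : (mu I < +oo)%E.
    exact/compact_finite_measure/segment_compact.
  have fkI : mu.-integrable [set` `[x, x + d n]]
      (EFin \o (fun z => (f z - f x) * k n z)).
    apply: (integrable_mul_bounded _ _ _ (n.+1%:R * C)) => //; first exact: fcI.
    apply: measurable_funTS; exact: continuous_measurable_fun.
  have fNI : mu.-integrable [set` `[x, x + d n]] (EFin \o (fun z => `|f z - f x|)).
    by apply: integrable_norm; exact: fcI.
  apply: le_trans (le_normr_Rintegral _ fkI) _ => //.
  apply: (@le_trans _ _ (\int[mu]_(z in `[x, x + d n]) (n.+1%:R * C * `|f z - f x|))).
    apply: le_Rintegral => //.
    - exact: (integrable_norm fkI).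
    - exact: (integrableZl (mI n) (n.+1%:R * C) fNI).
    by move=> z _; rewrite normrM mulrC ler_wpM2r.
  rewrite RintegralZl// ler_wpM2l ?mulr_ge0//.
  apply: fine_le.
  - exact: (integrable_fin_num (mI n) fNI).
  - exact: (integrable_fin_num mJ fcJ).
  - apply: (ge0_subset_integral _ (mI n) mJ) => //.
    exact: (measurable_int mu fcJ).
have dd0 : 2 * d n @[n --> \oo] --> (0 : R).
  by rewrite -[X in _ --> X](mulr0 2); apply: cvgM; [exact: cvg_cst|exact: cvg_harmonic].
have dd : 2 * d n @[n --> \oo] --> (0 : R)^'+.
  move=> P P0; have : \forall n \near \oo, 0 < 2 * d n -> P (2 * d n) := dd0 _ P0.
  by apply: filterS => n; apply; exact: mulr_gt0.
have davg0 : 4 * C * fine (davg f x (2 * d n)) @[n --> \oo] --> 0.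
  rewrite -[X in _ --> X](mulr0 (4 * C)); apply: cvgM; first exact: cvg_cst.
  by apply: fine_cvg; exact: (cvg_comp _ _ dd fx).
apply/cvgrPdist_le => e e0; near=> n.
rewrite distrC; apply: le_trans (bnd n) _.
apply: le_trans (ler_norm _) _; near: n.
by have /cvgr0Pnorm_le := davg0; apply.
Unshelve. all: by end_near. Qed.

(** The factors converge pointwise to the indicator of ]x, y], left-open because S vanishes at 0,
    and are bounded by 1; dominated convergence with majorant |g| concludes. *)
Lemma smooth_indicator_cvg (S g : R -> R) x y : x < y -> continuous S ->
  (forall z, z <= 0 -> S z = 0) -> (forall z, 1 <= z -> S z = 1) ->
  (forall z, 0 <= S z <= 1) -> mu.-integrable setT (EFin \o g) ->
  \int[mu]_z (g z * (S (n.+1%:R * (z - x)) - S (n.+1%:R * (z - y))))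
    @[n --> \oo] --> \int[mu]_(z in `[x, y]) g z.
Proof.
move=> xy cS S0 S1 S01 gi.
pose p (n : nat) z := S (n.+1%:R * (z - x)) - S (n.+1%:R * (z - y)).
have mI : measurable ([set` `]x, y]] : set (measurableTypeR R)) by exact: measurable_itv.
have gI : mu.-integrable [set` `]x, y]] (EFin \o g) by exact: integrableS gi.
rewrite -Rintegral_itv_obnd_cbnd// [X in _ --> X]Rintegral_mkcond.
have mg := measurable_int mu gi.
have cp n : continuous (p n).
  by move=> z; apply: cvgB; exact: continuous_affine_comp cS _.
have p1 n z : `|p n z| <= 1.
  rewrite ler_norml /p; have := S01 (n.+1%:R * (z - x)).
  by have := S01 (n.+1%:R * (z - y)); lra.
have S1near (c : R) : 0 < c -> \forall n \near \oo, S (n.+1%:R * c) = 1.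
  move=> c0; have [N _ hN] := near_infty_natSinv_lt (PosNum c0).
  exists N => // n /hN /= nc; apply: S1.
  by rewrite mulrC -ler_pdivrMr// mul1r ltW.
have S0n n (c : R) : c <= 0 -> S (n.+1%:R * c) = 0.
  by move=> c0; apply: S0; rewrite pmulr_rle0.
have gpi n : mu.-integrable setT (EFin \o (fun z => g z * p n z)).
  apply: (integrable_mul_bounded _ _ _ 1) => //.
  exact: continuous_measurable_fun.
have gri : mu.-integrable setT (EFin \o (g \_ `]x, y])).
  rewrite -restrict_EFin; exact/(integrable_mkcond _ mI).1.
apply: fine_cvg; rewrite fineK; last exact: (integrable_fin_num measurableT gri).
apply: (@dominated_cvg _ _ _ mu setT measurableT _ _ (fun z => `|g z|%:E)) => //.
- by move=> n; exact: (measurable_int mu (gpi n)).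
- move=> z _; apply: cvg_EFin; first exact: nearW.
  apply: cvg_near_cst.
  rewrite /= patchE mem_setE in_itv /=; case: ifPn.
    move=> /andP[xz zy]; have := S1near (z - x); rewrite subr_gt0 => /(_ xz).
    apply: filterS => n ->; rewrite S0n ?subr_le0//.
    by rewrite subr0 mulr1.
  rewrite negb_and -leNgt -ltNge => /orP[zx|yz].
    have zy : z <= y := le_trans zx (ltW xy).
    by apply: nearW => n; rewrite !S0n ?subr_le0// subrr mulr0.
  have := S1near (z - x); have := S1near (z - y); rewrite !subr_gt0 => /(_ yz) h1.
  move=> /(_ (lt_trans xy yz)); apply: filterS2 h1 => n -> ->.
  by rewrite subrr mulr0.
- exact: (integrable_norm gi).
- move=> n z _; rewrite /comp abse_EFin lee_fin -[leLHS]/(`|g z * p n z|) normrM ler_piMr//.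
Qed.

Lemma locally_integrable_compact D (K : set R) g : locally_integrable D g ->
  compact K -> K `<=` D -> mu.-integrable K (EFin \o g).
Proof.
move=> [mg oD gK] cK KD; apply/integrableP; split; last exact: gK.
apply/measurable_EFinP; apply: measurable_funS mg => //.
exact: open_measurable.
Qed.

(** The weak identity is tested on smooth approximations of the indicator of ]x, y]. Their
    derivatives are the one-sided kernels at x minus those at y, so one side tends to f x - f y and
    the other to minus the integral of g. *)
Lemma weak_derivative_FTC (a b x y : R) f g :
  mu.-integrable [set` `]a, b[] (EFin \o f) ->
  weak_derivative `]a, b[ f g -> a < x -> x < y -> y < b ->
  lebesgue_pt (f \_ `]a, b[) x -> lebesgue_pt (f \_ `]a, b[) y ->
  \int[mu]_(z in `[x, y]) g z = f y - f x.
Proof.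
move=> fi [_ gl fg] ax xy yb fx fy.
have [S [dS [C [Sn SdS cdS dSC [S0 S1 S01 dS0]]]]] := @smooth_step_exists R.
have cS : continuous S := is_derive_continuous _ _ SdS.
have mD : measurable ([set` `]a, b[] : set (measurableTypeR R)) by exact: measurable_itv.
have Fi : mu.-integrable setT (EFin \o (f \_ `]a, b[)).
  by rewrite -restrict_EFin; exact/(integrable_mkcond _ mD).1.
(* The approximations extend to the right of y by 1/(n+1), so room is kept before b. As g is only
   locally integrable on ]a, b[, it is cut off to the compact [K], which contains their supports for
   large n. *)
pose e := (b - y) / 2.
have e0 : 0 < e by rewrite divr_gt0// subr_gt0.
pose K : set (measurableTypeR R) := [set` `[x, y + e]].
have cK : compact K by exact: segment_compact.
have mK : measurable K by exact: measurable_itv.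
have KD : K `<=` `]a, b[.
  move=> z; rewrite /K /= !in_itv /= => /andP[xz zy].
  by rewrite (lt_le_trans ax xz) (le_lt_trans zy)// /e; lra.
have gi : mu.-integrable K (EFin \o g) := locally_integrable_compact _ _ _ gl cK KD.
have Gi : mu.-integrable setT (EFin \o (g \_ K)).
  by rewrite -restrict_EFin; exact/(integrable_mkcond _ mK).1.
pose k c (n : nat) z := n.+1%:R * dS (n.+1%:R * (z - c)).
pose p (n : nat) z := S (n.+1%:R * (z - x)) - S (n.+1%:R * (z - y)).
have ck c n : continuous (k c n).
  move=> z; apply: cvgM; first exact: cvg_cst.
  exact: continuous_affine_comp cdS _.
have Fki c n : mu.-integrable setT (EFin \o (fun z => (f \_ `]a, b[) z * k c n z)).
  apply: (integrable_mul_bounded _ _ _ (n.+1%:R * C)) => //.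
    exact: continuous_measurable_fun.
  by move=> z _; rewrite normrM gtr0_norm// ler_wpM2l.
have dp n z : is_derive z (1 : R) (p n) (k x n z - k y n z).
  have -> : p n = (S \o (cst n.+1%:R * (id - cst x))) -
    (S \o (cst n.+1%:R * (id - cst y))) by [].
  apply: is_derive_eq.
  by rewrite !subr0 !scaler0 !addr0 /GRing.scale /= mulr1 ![dS _ * _]mulrC.
have pK : \forall n \near \oo, forall z, ~ K z -> p n z = 0.
  have [N _ hN] := near_infty_natSinv_lt (PosNum e0).
  exists N => // n /hN /= ne z; rewrite /K /= in_itv /= => /negP.
  have n0 : 0 < n.+1%:R :> R by [].
  rewrite negb_and -!ltNge => /orP[zx|yz].
    by rewrite /p !S0 ?subrr// pmulr_rle0// subr_le0 ltW// (lt_trans zx).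
  have yz1 : 1 <= n.+1%:R * (z - y).
    by rewrite mulrC -ler_pdivrMr// mul1r; apply/ltW/(lt_trans ne); rewrite ltrBrDl.
  rewrite /p !S1 ?subrr//; apply: le_trans yz1 _.
  by rewrite ler_wpM2l ?(ltW n0)// lerB// ltW.
have test n : (forall z, ~ K z -> p n z = 0) -> test_function `]a, b[ (p n).
  move=> pn0; have cl : closure [set z | p n z != 0] `<=` K.
    rewrite (closure_id K).1; last exact: compact_closed.
    apply: closure_subset => z /= pz; apply: contrapT => /pn0 pz0.
    by rewrite pz0 eqxx in pz.
  split.
  - apply: diff_upto_derive1n => m.
    have -> : p n = (fun z => S (n.+1%:R * z + - (n.+1%:R * x))) +
        - (fun z => S (n.+1%:R * z + - (n.+1%:R * y))).
      by apply/funext => z; rewrite /p !mulrBr.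
    by apply: diff_uptoD; [|apply: diff_uptoN]; apply: diff_upto_affine.
  - by apply: subclosed_compact cK cl; exact: closed_closure.
  - exact: subset_trans cl KD.
have lhs n : \int[mu]_(z in `]a, b[) (f z * derive1 (p n) z) =
    \int[mu]_z ((f \_ `]a, b[) z * k x n z) - \int[mu]_z ((f \_ `]a, b[) z * k y n z).
  rewrite -RintegralB// Rintegral_mkcond; congr Rintegral; apply/funext => z.
  rewrite !patchE; case: ifPn => _; last by rewrite !mul0r subrr.
  by rewrite derive1E (@derive_val _ _ _ _ _ _ _ (dp n z)) mulrBr.
have rhs n : (forall z, ~ K z -> p n z = 0) ->
    \int[mu]_(z in `]a, b[) (g z * p n z) = \int[mu]_z ((g \_ K) z * p n z).
  move=> pn0; rewrite (Rintegral_support K)//; last first.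
    by move=> z _ /pn0 ->; rewrite mulr0.
  rewrite [RHS](Rintegral_support K)//; last first.
    by move=> z _ /pn0 ->; rewrite mulr0.
  by apply: eq_Rintegral => z zK; rewrite patchE zK.
have limk c : lebesgue_pt (f \_ `]a, b[) c ->
    \int[mu]_z ((f \_ `]a, b[) z * k c n z) @[n --> \oo] --> (f \_ `]a, b[) c.
  by apply: (lebesgue_pt_kernel _ S C) => //; [exact: S0|exact: S1].
have lim1 : (\int[mu]_z ((f \_ `]a, b[) z * k x n z) -
    \int[mu]_z ((f \_ `]a, b[) z * k y n z)) @[n --> \oo] -->
    (f \_ `]a, b[) x - (f \_ `]a, b[) y by apply: cvgB; exact: limk.
have lim2 : (- \int[mu]_z ((g \_ K) z * p n z)) @[n --> \oo] -->
    - \int[mu]_(z in `[x, y]) (g \_ K) z.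
  by apply: cvgN; exact: (smooth_indicator_cvg S).
have : (f \_ `]a, b[) x - (f \_ `]a, b[) y = - \int[mu]_(z in `[x, y]) (g \_ K) z.
  apply: (cvg_unique (@Rhausdorff R) lim1).
  apply: cvg_trans lim2; apply: near_eq_cvg; near=> n.
  have pn0 : forall z, ~ K z -> p n z = 0 by near: n.
  have := fg _ (test n pn0); rewrite lhs (rhs _ pn0) => eqn.
  by rewrite -eqn.
have xD : x \in `]a, b[ by rewrite in_itv /= ax (lt_trans xy).
have yD : y \in `]a, b[ by rewrite in_itv /= yb (lt_trans ax).
rewrite !patchE !mem_setE xD yD => fxy.
have -> : \int[mu]_(z in `[x, y]) g z = \int[mu]_(z in `[x, y]) (g \_ K) z.
  apply: eq_Rintegral => z; rewrite inE /= in_itv /= => /andP[xz zy].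
  rewrite patchE /K mem_setE in_itv /= xz /= ifT//.
  by apply: le_trans zy _; rewrite lerDl ltW.
by rewrite -[LHS]opprK -fxy opprB.
Unshelve. all: by end_near. Qed.

End weak_derivative_FTC.

(** * Absolutely continuous functions *)

(* Bisecting the range of M halves the bound on `|H t - H s| each time. *)
Lemma quadratic_increment_cst (R : realType) (H M : R -> R) (s t : R) : s <= t ->
  {within `[s, t], continuous M} ->
  (forall x y, s <= x -> x <= y -> y <= t ->
    `|H y - H x| <= (M y - M x) ^+ 2) ->
  H t = H s.
Proof.
move=> st cM HM.
have halving n x y : s <= x -> x <= y -> y <= t ->
    `|H y - H x| <= (M y - M x) ^+ 2 / 2 ^+ n.
  elim: n x y => [|n IH] x y sx xy yt; first by rewrite expr0 divr1 HM.
  have cMxy : {within `[x, y], continuous M}.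
    by apply: continuous_subspaceW cM; apply: subset_itvScc; rewrite bnd_simp.
  have [|c] := @IVT _ M x y ((M x + M y) / 2) xy cMxy.
    by rewrite ge_min le_max; have [h|h] := leP (M x) (M y); apply/andP; split; apply/orP; lra.
  rewrite in_itv /= => /andP[xc cy] Mc.
  have h1 := IH x c sx xc (le_trans cy yt).
  have h2 := IH c y (le_trans sx xc) cy yt.
  have -> : H y - H x = (H y - H c) + (H c - H x) by ring.
  apply: le_trans (ler_normD _ _) _; apply: le_trans (lerD h2 h1) _.
  have N0 : 2 ^+ n != 0 :> R by rewrite expf_neq0.
  rewrite Mc (exprS 2 n); move: (2 ^+ n) N0 => N N0.
  by rewrite le_eqVlt; apply/orP; left; apply/eqP; field.
apply/eqP; rewrite -subr_eq0 -normr_le0 leNgt; apply/negP => h0.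
(* Halving on all of [s, t] would give 2^n <= B for every n, which fails as soon as n exceeds B. *)
pose B := (M t - M s) ^+ 2 / `|H t - H s|.
have B0 : 0 <= B by rewrite divr_ge0 ?sqr_ge0.
have := halving (Num.trunc B).+1 s t (lexx _) st (lexx _).
rewrite ler_pdivlMr ?exprn_gt0// mulrC -ler_pdivlMr// -/B leNgt.
move=> /negP; apply.
apply: lt_le_trans (truncnS_gt _) _.
by rewrite -natrX ler_nat ltnW// ltn_expl.
Qed.

(** Absolute continuity as an indefinite integral. The density is kept explicit because it plays the
    role of the derivative in the quadratic form. *)
Definition abs_cont (R : realType) (s t : R) (u g : R -> R) : Prop :=
  (@lebesgue_measure R).-integrable [set` `[s, t]] (EFin \o g) /\
  forall x, s <= x <= t ->
    u x = u s + \int[@lebesgue_measure R]_(z in `[s, x]) g z.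

Section absolutely_continuous.
Context {R : realType}.
Local Notation mu := (@lebesgue_measure R).
Implicit Types (f g h u v k : R -> R) (s t x y : R).

Lemma integrable_subitv s t x y g : s <= x -> y <= t ->
  mu.-integrable [set` `[s, t]] (EFin \o g) ->
  mu.-integrable [set` `[x, y]] (EFin \o g).
Proof.
move=> sx yt; apply: integrableS => //.
by apply: subset_itvScc; rewrite bnd_simp.
Qed.

Lemma Rintegral_itv_split s x y g : s <= x -> x <= y ->
  mu.-integrable [set` `[s, y]] (EFin \o g) ->
  \int[mu]_(z in `[s, y]) g z =
  \int[mu]_(z in `[s, x]) g z + \int[mu]_(z in `[x, y]) g z.
Proof.
move=> sx xy gi; apply/eqP; rewrite addrC -subr_eq; apply/eqP.
rewrite Rintegral_itvB ?bnd_simp// Rintegral_itv_obnd_cbnd//.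
apply: integrableS gi => //.
by move=> z /=; rewrite !in_itv /= => /andP[xz ->]; rewrite (le_trans sx (ltW xz)).
Qed.

Lemma abs_contB s t u g x y : abs_cont R s t u g -> s <= x -> x <= y -> y <= t ->
  u y - u x = \int[mu]_(z in `[x, y]) g z.
Proof.
move=> [gi ug] sx xy yt; rewrite (ug y) ?(le_trans sx)//= (ug x) ?sx ?(le_trans xy)//.
rewrite (Rintegral_itv_split s x y)//; first by ring.
exact: integrable_subitv gi.
Qed.

Lemma abs_cont_continuous s t u g : s <= t -> abs_cont R s t u g ->
  {within `[s, t], continuous u}.
Proof.
move=> st [gi ug].
have := parameterized_integral_continuous st gi => cI.
apply: (@subspace_eq_continuous _ _ _ (fun x => u s + parameterized_integral mu s x g)).
  by move=> x; rewrite inE /= in_itv /= => /ug.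
by move=> x; apply: cvgD; [exact: cvg_cst|exact: cI].
Qed.

Lemma integrable_mul_continuous s t g v :
  {within `[s, t], continuous v} ->
  mu.-integrable [set` `[s, t]] (EFin \o g) ->
  mu.-integrable [set` `[s, t]] (EFin \o (fun z => g z * v z)).
Proof.
move=> cv gi; have [M [_ hM]] := 
  compact_bounded (continuous_compact cv (segment_compact (a := s) (b := t))).
apply: (integrable_mul_bounded _ _ _ (M + 1)) => //.
  exact: subspace_continuous_measurable_fun.
by move=> x xst; apply: (hM (M + 1)); rewrite ?ltrDl//=; exists x.
Qed.

Lemma integrable_addE (A : set (measurableTypeR R)) f h : measurable A ->
  mu.-integrable A (EFin \o f) -> mu.-integrable A (EFin \o h) ->
  mu.-integrable A (EFin \o (fun z => f z + h z)).
Proof. by move=> mA fi hi; exact: (integrableD mA fi hi). Qed.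

Lemma integrable_scaleE (A : set (measurableTypeR R)) c f : measurable A ->
  mu.-integrable A (EFin \o f) -> mu.-integrable A (EFin \o (fun z => c * f z)).
Proof. by move=> mA fi; exact: (integrableZl mA c fi). Qed.

Lemma abs_cont_incr_le s t x y p q u g : abs_cont R s t u g ->
  s <= x -> x <= p -> p <= q -> q <= y -> y <= t ->
  `|u q - u p| <= \int[mu]_(z in `[x, y]) `|g z|.
Proof.
move=> ug sx xp pq qy yt.
have sub a b : x <= a -> b <= y -> mu.-integrable [set` `[a, b]] (EFin \o g).
  by move=> xa bY; apply: integrable_subitv ug.1; [exact: le_trans xa|exact: le_trans yt].
have subn a b : x <= a -> b <= y -> mu.-integrable [set` `[a, b]] (EFin \o (fun z => `|g z|)).
  by move=> xa bY; apply: integrable_norm; exact: sub.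
rewrite (abs_contB _ _ _ _ _ _ ug) ?(le_trans sx)// ?(le_trans qy)//.
apply: le_trans (le_normr_Rintegral _ _) _ => //; first exact: sub.
rewrite (Rintegral_itv_split x p y) ?(le_trans pq)//; last exact: subn.
rewrite (Rintegral_itv_split p q y)//; last exact: subn.
rewrite addrCA lerDl addr_ge0//; exact: Rintegral_ge0.
Qed.

(** The defect [H] between the product and the integral of the Leibniz density has increments
    bounded by the squared increments of the continuous primitive of |g| + |k|;
    [quadratic_increment_cst] then makes it constant. *)
Lemma abs_contM s t u v g k : s <= t ->
  abs_cont R s t u g -> abs_cont R s t v k ->
  abs_cont R s t (fun z => u z * v z) (fun z => g z * v z + k z * u z).
Proof.
move=> st ug vk; have cu := abs_cont_continuous _ _ _ _ st ug.
have cv := abs_cont_continuous _ _ _ _ st vk.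
have [gi ki] := (ug.1, vk.1).
have mI x y : measurable ([set` `[x, y]] : set (measurableTypeR R)) by exact: measurable_itv.
have gvi := integrable_mul_continuous _ _ _ _ cv gi.
have kui := integrable_mul_continuous _ _ _ _ cu ki.
have dens : mu.-integrable [set` `[s, t]] (EFin \o (fun z => g z * v z + k z * u z)).
  exact: integrable_addE.
split => // x0 /andP[sx0 x0t].
pose H x := u x * v x - \int[mu]_(z in `[s, x]) (g z * v z + k z * u z).
pose a z := `|g z| + `|k z|.
have ai : mu.-integrable [set` `[s, t]] (EFin \o a).
  by apply: integrable_addE; [exact: mI|exact: integrable_norm gi|exact: integrable_norm ki].
suff : H x0 = H s by rewrite /H set_itv1 Rintegral_set1; lra.
apply: (quadratic_increment_cst _ _ (fun x => parameterized_integral mu s x a)) => //.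
  apply: parameterized_integral_continuous => //.
  exact: integrable_subitv (lexx _) x0t ai.
move=> x y sx xy yx0; have yt := le_trans yx0 x0t.
have sub f : mu.-integrable [set` `[s, t]] (EFin \o f) ->
  mu.-integrable [set` `[x, y]] (EFin \o f) by exact: integrable_subitv.
have subs f : mu.-integrable [set` `[s, t]] (EFin \o f) ->
  mu.-integrable [set` `[s, y]] (EFin \o f) by exact: integrable_subitv.
rewrite /parameterized_integral (Rintegral_itv_split s x y a)//; last exact: subs.
rewrite [X in (X - _) ^+ 2]addrC addrK.
have gni : mu.-integrable [set` `[x, y]] (EFin \o (fun z => `|g z|)).
  by apply/integrable_norm/sub.
have kni : mu.-integrable [set` `[x, y]] (EFin \o (fun z => `|k z|)).
  by apply/integrable_norm/sub.
rewrite /a RintegralD//.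
set G := \int[mu]_(z in `[x, y]) `|g z|; set K := \int[mu]_(z in `[x, y]) `|k z|.
have G0 : 0 <= G by apply: Rintegral_ge0.
have K0 : 0 <= K by apply: Rintegral_ge0.
have gE : \int[mu]_(z in `[x, y]) g z = u y - u x.
  by rewrite (abs_contB _ _ _ _ _ _ ug).
have kE : \int[mu]_(z in `[x, y]) k z = v y - v x.
  by rewrite (abs_contB _ _ _ _ _ _ vk).
have scl c f : mu.-integrable [set` `[x, y]] (EFin \o f) ->
    mu.-integrable [set` `[x, y]] (EFin \o (fun z => c * f z)).
  by apply: integrable_scaleE; exact: mI.
have add f h : mu.-integrable [set` `[x, y]] (EFin \o f) ->
    mu.-integrable [set` `[x, y]] (EFin \o h) ->
    mu.-integrable [set` `[x, y]] (EFin \o (fun z => f z + h z)).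
  by apply: integrable_addE; exact: mI.
have [gi' ki'] := (sub _ gi, sub _ ki).
have cE : mu.-integrable [set` `[x, y]] (EFin \o (fun z => v y * g z + u x * k z)).
  by apply: add; exact: scl.
(* Both differences below are bounded by G or K, so the increment of H is of second order. *)
have HE : H y - H x =
    \int[mu]_(z in `[x, y]) (g z * (v y - v z) + k z * (u x - u z)).
  rewrite /H (Rintegral_itv_split s x y (fun z => g z * v z + k z * u z))//; last first.
    exact: subs.
  transitivity (\int[mu]_(z in `[x, y])
      ((v y * g z + u x * k z) - (g z * v z + k z * u z))).
    rewrite RintegralB//; last exact: sub.
    have -> : \int[mu]_(z in `[x, y]) (v y * g z + u x * k z)
        = v y * (u y - u x) + u x * (v y - v x).
      by rewrite RintegralD//; [rewrite !RintegralZl// gE kE|exact: (scl (v y))|exact: (scl (u x))].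
    by ring.
  by apply: eq_Rintegral => z _; ring.
have Ei : mu.-integrable [set` `[x, y]]
    (EFin \o (fun z => g z * (v y - v z) + k z * (u x - u z))).
  have -> : (fun z => g z * (v y - v z) + k z * (u x - u z)) =
      (fun z => (v y * g z + u x * k z) + (-1) * (g z * v z + k z * u z)).
    by apply/funext => z; ring.
  by apply: add => //; apply: scl; exact: sub.
rewrite HE; apply: le_trans (le_normr_Rintegral _ Ei) _ => //.
apply: (@le_trans _ _ (\int[mu]_(z in `[x, y]) (K * `|g z| + G * `|k z|))).
  apply: le_Rintegral => //.
  - exact: (integrable_norm Ei).
  - by apply: add; exact: scl.
  - move=> z /=; rewrite in_itv /= => /andP[xz zy].
    apply: le_trans (ler_normD _ _) _; rewrite !normrM [K * _]mulrC [G * _]mulrC.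
    apply: lerD; apply: ler_wpM2l => //.
      exact: (abs_cont_incr_le _ _ _ _ _ _ _ _ vk).
    by rewrite distrC; exact: (abs_cont_incr_le _ _ _ _ _ _ _ _ ug).
rewrite RintegralD//; [|exact: (scl K)|exact: (scl G)].
rewrite !RintegralZl// -/G -/K.
have := sqr_ge0 G; have := sqr_ge0 K.
have -> : (G + K) ^+ 2 = G ^+ 2 + K ^+ 2 + 2 * (G * K) by ring.
lra.
Qed.

End absolutely_continuous.

(** * Integrating the certificate *)

Section energy.
Context {R : realType}.
Local Notation mu := (@lebesgue_measure R).
Implicit Types (f g h u v k : R -> R) (s t x y : R).

Lemma abs_contD s t u v g k :
  abs_cont R s t u g -> abs_cont R s t v k ->
  abs_cont R s t (fun z => u z + v z) (fun z => g z + k z).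
Proof.
move=> [gi ug] [ki vk]; split; first exact: integrable_addE.
move=> x /[dup] sxt /andP[sx xt]; rewrite (ug x)// (vk x)// RintegralD//.
- by ring.
- exact: integrable_subitv gi.
- exact: integrable_subitv ki.
Qed.

Lemma abs_cont_derive s t u g : s <= t ->
  (forall x : R, is_derive x (1 : R) u (g x)) -> continuous g ->
  abs_cont R s t u g.
Proof.
move=> st du cg.
have cu : continuous u := is_derive_continuous _ _ du.
split.
  apply: continuous_compact_integrable; first exact: segment_compact.
  exact: continuous_subspaceT.
move=> x /andP[]; rewrite le_eqVlt => /predU1P[<- _|sx xt].
  by rewrite set_itv1 Rintegral_set1 addr0.
rewrite /Rintegral (@continuous_FTC2 _ g u)//.
- by rewrite -EFinB /= addrCA subrr addr0.
- exact: continuous_subspaceT.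
- split; first by move=> z _; have [] := du z.
  + exact/cvg_at_right_filter/cu.
  + exact/cvg_at_left_filter/cu.
- by move=> z _; rewrite derive1E; have [] := du z.
Qed.

Lemma zp_eval_continuous p : continuous (zp_eval R p).
Proof. by apply: is_derive_continuous => x; exact: zp_eval_derive. Qed.

Lemma ae_ge0_Rintegral (A : set (measurableTypeR R)) f : measurable A ->
  mu.-integrable A (EFin \o f) -> {ae mu, forall z, A z -> 0 <= f z} ->
  0 <= \int[mu]_(z in A) f z.
Proof.
move=> mA fi f0.
have -> : \int[mu]_(z in A) f z = \int[mu]_(z in A) `|f z|.
  congr fine; apply: ae_eq_integral => //.
  - exact: measurable_int fi.
  - exact: (measurable_int mu (integrable_norm fi)).
  - by apply: filterS f0 => z h /h fz; rewrite /= ger0_norm.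
exact: Rintegral_ge0.
Qed.

Definition storage (x u F : R) : R :=
  zp_eval R cert_a x * u ^+ 2 + 2 * zp_eval R cert_b x * u * F
  + zp_eval R cert_d x * F ^+ 2.

(** Along the absolutely continuous u and F, the Leibniz rule gives the storage an integrable
    density; [e] plus this density is the form of [cert_ge0] wherever u agrees with Phi, hence
    almost everywhere. *)
Lemma energy_storage_ge0 s t Phi g q u F : 0 <= s -> s <= t -> t <= 1 ->
  abs_cont R s t u g -> {ae mu, forall z, s <= z <= t -> u z = Phi z} ->
  abs_cont R s t F q -> (forall z, s <= z <= t -> q z = (3 - 2 * z) * Phi z) ->
  let e z := 300 * ((7 - 3 * z) * z * (1 - z) ^+ 2 * g z ^+ 2)
    - 301 * ((1 - z) * (12 - z) * Phi z ^+ 2) in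
  mu.-integrable [set` `[s, t]] (EFin \o e) ->
  0 <= \int[mu]_(z in `[s, t]) e z + (storage t (u t) (F t) - storage s (u s) (F s)).
Proof.
move=> s0 st t1 ug uPhi Fq qE e ei.
have za p : abs_cont R s t (zp_eval R p) (zp_eval R (zp_deriv p)).
  apply: abs_cont_derive => //; last exact: zp_eval_continuous.
  by move=> x; exact: zp_eval_derive.
have uu := abs_contM _ _ _ _ _ _ st ug ug.
have uF := abs_contM _ _ _ _ _ _ st ug Fq.
have FF := abs_contM _ _ _ _ _ _ st Fq Fq.
have auu := abs_contM _ _ _ _ _ _ st (za cert_a) uu.
have buF := abs_contM _ _ _ _ _ _ st (za cert_b) uF.
have dFF := abs_contM _ _ _ _ _ _ st (za cert_d) FF.
(* The term b u F is added twice to produce the coefficient 2 b. *)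
have := abs_contD _ _ _ _ _ _
  (abs_contD _ _ _ _ _ _ auu (abs_contD _ _ _ _ _ _ buF buF)) dFF.
set S := fun z => _; set sig := fun z => _ => SS.
have SE x : S x = storage x (u x) (F x) by rewrite /S /storage; ring.
rewrite -!SE (abs_contB _ _ _ _ _ _ SS)// -RintegralD//; last exact: SS.1.
apply: ae_ge0_Rintegral => //.
  by apply: integrable_addE => //; exact: SS.1.
apply: (@filterS _ _ (ae_filter_ringOfSetsType mu) _ _ _ uPhi) => z uz.
rewrite /= in_itv /= => /[dup] /uz {}uz zst.
have z01 : 0 <= z <= 1.
  by case/andP: zst => sz zt; rewrite (le_trans s0) ?(le_trans zt).
have := cert_ge0 z (u z) (g z) (F z) z01.
by rewrite /e /sig -uz (qE z zst) -uz; congr (_ <= _); ring.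
Qed.

(** A null set cannot contain an interval of positive length. *)
Lemma ae_exists_itvoo (P : R -> Prop) x y : {ae mu, forall z, P z} -> x < y ->
  exists2 z, x < z < y & P z.
Proof.
move=> [N [mN N0 PN]] xy; apply: contrapT => nP.
have : (mu [set` `]x, y[] <= mu N)%E.
  apply: le_measure; rewrite ?inE//.
  move=> z /=; rewrite in_itv /= => xzy; apply: PN => /= Pz.
  by apply: nP; exists z.
rewrite N0 lebesgue_measure_itv /= lte_fin xy -EFinB lee_fin.
by rewrite leNgt subr_gt0 xy.
Qed.

Lemma ae_exists_at_right (P : R -> Prop) (Q : set R) x :
  {ae mu, forall z, P z} -> (\forall z \near x^'+, Q z) -> exists2 z, P z & Q z.
Proof.
move=> aeP [e /= e0 Qe].
have [|z /andP[xz zx] Pz] := ae_exists_itvoo P x (x + e) aeP; first by rewrite ltrDl.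
exists z => //; apply: Qe => //=.
by rewrite ltr0_norm ?subr_lt0// opprB ltrBlDl.
Qed.

Lemma ae_exists_at_left (P : R -> Prop) (Q : set R) x :
  {ae mu, forall z, P z} -> (\forall z \near x^'-, Q z) -> exists2 z, P z & Q z.
Proof.
move=> aeP [e /= e0 Qe].
have [|z /andP[xz zx] Pz] := ae_exists_itvoo P (x - e) x aeP; first by rewrite gtrBl.
exists z => //; apply: Qe => //=.
by rewrite gtr0_norm ?subr_gt0//; lra.
Qed.

End energy.

(** * Passage to the endpoints 0 and 1 *)

Section assembly.
Context {R : realType}.
Local Notation mu := (@lebesgue_measure R).
Implicit Types (f g h u v k : R -> R) (s t x y : R).

(** Extending f by zero puts its primitive on the closed interval, where continuity yields both
    one-sided endpoint limits. *)
Lemma primitive01 f : mu.-integrable [set` `]0, 1[] (EFin \o f) ->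
  let F x := \int[mu]_(z in `[0, x]) (f \_ `]0, 1[) z in
  [/\ abs_cont R 0 1 F (f \_ `]0, 1[), F 0 = 0,
      F 1 = \int[mu]_(z in `]0, 1[) f z,
      F @ 0^'+ --> 0 & F @ 1^'- --> \int[mu]_(z in `]0, 1[) f z].
Proof.
move=> fi F.
have mD : measurable ([set` `]0, 1[] : set (measurableTypeR R)) by exact: measurable_itv.
have fri : mu.-integrable setT (EFin \o (f \_ `]0, 1[)).
  by rewrite -restrict_EFin; exact/(integrable_mkcond _ mD).1.
have fri01 : mu.-integrable [set` `[0, 1]] (EFin \o (f \_ `]0, 1[)).
  exact: integrableS fri.
have F0 : F 0 = 0 by rewrite /F set_itv1 Rintegral_set1.
have F1 : F 1 = \int[mu]_(z in `]0, 1[) f z.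
  rewrite /F (Rintegral_support [set` `]0, 1[]).
  - by apply: eq_Rintegral => z zD; rewrite patchE zD.
  - by move=> z /=; rewrite !in_itv /= => /andP[/ltW -> /ltW ->].
  - by move=> z _ /negP zD; rewrite patchE mem_setE (negbTE zD).
have FA : abs_cont R 0 1 F (f \_ `]0, 1[).
  by split => // x _; rewrite F0 add0r.
split => //.
  have /(continuous_within_itvP _ ltr01)[_ + _] := abs_cont_continuous _ _ _ _ ler01 FA.
  by rewrite F0.
have /(continuous_within_itvP _ ltr01)[_ _ +] := abs_cont_continuous _ _ _ _ ler01 FA.
by rewrite F1.
Qed.

Lemma abs_cont_sub s t x y u g : s <= x -> x <= y -> y <= t ->
  abs_cont R s t u g -> abs_cont R x y u g.
Proof.
move=> sx xy yt ug; split; first exact: integrable_subitv ug.1.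
move=> z /andP[xz zy]; rewrite -(abs_contB _ _ _ _ _ _ ug)//; first by ring.
exact: le_trans yt.
Qed.

Lemma integrable_nonneg (D : set (measurableTypeR R)) f : measurable D ->
  measurable_fun D f -> (forall z, D z -> 0 <= f z) ->
  (\int[mu]_(z in D) (f z)%:E < +oo)%E -> mu.-integrable D (EFin \o f).
Proof.
move=> mD mf f0 foo; apply/integrableP; split; first exact/measurable_EFinP.
rewrite (_ : (\int[mu]_(z in D) `|(EFin \o f) z|)%E = (\int[mu]_(z in D) (f z)%:E)%E)//.
by apply: eq_integral => z /set_mem zD; rewrite /= ger0_norm ?f0.
Qed.

Lemma measurable_weighted (D : set (measurableTypeR R)) (w : R -> R) f : measurable D ->
  continuous w -> measurable_fun D f -> measurable_fun D (fun z => w z * f z ^+ 2).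
Proof.
move=> mD cw mf; apply: measurable_funM; last exact: measurable_funX.
by apply: measurable_funTS; exact: continuous_measurable_fun.
Qed.


(** The left side tends to 0 as s tends to 0, and the right side to E1 + 1000 F1^2 as t tends to 1,
    because d(1) = 1000. Good points have full measure, so they exist arbitrarily close to each
    endpoint. *)
Lemma boundary_limit (good : R -> Prop) (E F : R -> R) (E1 F1 C : R) :
  {ae mu, forall z, good z} ->
  E @ 0^'+ --> 0 -> F @ 0^'+ --> 0 -> E @ 1^'- --> E1 -> F @ 1^'- --> F1 ->
  (forall s t, good s -> good t -> 0 < s <= 1 / 100 -> 99 / 100 <= t < 1 ->
    E s - C * F s ^+ 2 <=
      E t + (zp_eval R cert_d t + 100 * 1000 * (1 - t)) * F t ^+ 2) ->
  0 <= E1 + 1000 * F1 ^+ 2.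
Proof.
move=> aeg E0 F0 E1c F1c h.
pose l s := E s - C * F s ^+ 2.
pose r t := E t + (zp_eval R cert_d t + 100 * 1000 * (1 - t)) * F t ^+ 2.
have l0 : l @ 0^'+ --> 0.
  rewrite [X in _ --> X](_ : 0 = 0 - C * (0 * 0)); last by ring.
  apply: cvgB => //; apply: cvgM; first exact: cvg_cst.
  by rewrite (_ : (fun s => F s ^+ 2) = F * F)//; exact: cvgM.
have r1 : r @ 1^'- --> E1 + 1000 * F1 ^+ 2.
  have -> : E1 + 1000 * F1 ^+ 2 =
      E1 + (zp_eval R cert_d 1 + 100 * 1000 * (1 - 1)) * (F1 * F1).
    by rewrite cert_d1; ring.
  apply: cvgD => //; apply: cvgM; last first.
    by rewrite (_ : (fun s => F s ^+ 2) = F * F)//; exact: cvgM.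
  apply: cvg_at_left_filter; apply: cvgD; first exact: zp_eval_continuous.
  by apply: cvgM; [exact: cvg_cst|apply: cvgB; [exact: cvg_cst|exact: cvg_id]].
(* If the limit were negative, its half [m] would separate the two sides at good points close enough
   to the endpoints. *)
rewrite leNgt; apply/negP => neg; pose m := (E1 + 1000 * F1 ^+ 2) / 2.
have [s gs /= [ls s0 s1]] : exists2 s, good s & [/\ m < l s, 0 < s & s <= 1 / 100].
  apply: (ae_exists_at_right _ [set s | [/\ m < l s, 0 < s & s <= 1 / 100]] 0 aeg).
  near=> s; split; near: s.
  - by apply: (cvgr_gt 0 l0); rewrite /m; lra.
  - exact: nbhs_right_gt.
  - by apply: nbhs_right_le; lra.
have [t gt /= [rt t0 t1]] : exists2 t, good t & [/\ r t < m, 99 / 100 <= t & t < 1].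
  apply: (ae_exists_at_left _ [set t | [/\ r t < m, 99 / 100 <= t & t < 1]] 1 aeg).
  near=> t; split; near: t.
  - by apply: (cvgr_lt _ r1); rewrite /m; lra.
  - by apply: nbhs_left_ge; lra.
  - exact: nbhs_left_lt.
have := h s t gs gt; rewrite s0 s1 t0 t1 => /(_ isT isT).
by rewrite -/(l s) -/(r t) leNgt (lt_trans rt ls).
Unshelve. all: by end_near. Qed.

End assembly.

(** * The weighted inequality on (0, 1) *)

Theorem proposition2p4 (R : realType) :
  exists c_P : R, 1 < c_P /\
  forall Phi Phi_y : R -> R,
    H1loc `]0%R, 1%R[ Phi ->
    (@lebesgue_measure R).-integrable `]0%R, 1%R[ (EFin \o Phi) ->
    weak_derivative `]0%R, 1%R[ Phi Phi_y ->
    (\int[@lebesgue_measure R]_(y in `]0%R, 1%R[)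
       ((7 - 3 * y) * y * (1 - y) ^+ 2 * Phi_y y ^+ 2)%:E < +oo)%E ->
    (\int[@lebesgue_measure R]_(y in `]0%R, 1%R[)
       ((1 - y) * (12 - y) * Phi y ^+ 2)%:E < +oo)%E ->
    \int[@lebesgue_measure R]_(y in `]0%R, 1%R[)
        ((7 - 3 * y) * y * (1 - y) ^+ 2 * Phi_y y ^+ 2)
      + 10 / 3 * (\int[@lebesgue_measure R]_(y in `]0%R, 1%R[)
                    ((3 - 2 * y) * Phi y)) ^+ 2
    >= c_P * \int[@lebesgue_measure R]_(y in `]0%R, 1%R[)
               ((1 - y) * (12 - y) * Phi y ^+ 2).
Proof.
(* The ratio of the two coefficients in [cert_ge0]. *)
exists (301 / 300); split; first by lra.
move=> Phi g _ Phii wd poo woo.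
pose mu := @lebesgue_measure R.
pose D : set (measurableTypeR R) := [set` `]0, 1[].
have mD : measurable D by exact: measurable_itv.
have mPhi : measurable_fun D Phi.
  apply/measurable_EFinP; exact: (measurable_int mu Phii).
have mg : measurable_fun D g by have [_ []] := wd.
have D01 (z : R) : D z -> 0 < z < 1 by rewrite /D /= in_itv.
have wp0 (z : R) : D z -> 0 <= (7 - 3 * z) * z * (1 - z) ^+ 2.
  move=> /D01 z01; apply: mulr_ge0; last exact: sqr_ge0.
  by apply: mulr_ge0; lra.
have ww0 (z : R) : D z -> 0 <= (1 - z) * (12 - z).
  by move=> /D01 z01; apply: mulr_ge0; lra.
have h3 (z : R) : D z -> `|3 - 2 * z| <= 3.
  by move=> /D01 z01; rewrite ger0_norm; lra.
pose p y := (7 - 3 * y) * y * (1 - y) ^+ 2 * g y ^+ 2.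
pose w y := (1 - y) * (12 - y) * Phi y ^+ 2.
have cp : continuous (fun y : R => (7 - 3 * y) * y * (1 - y) ^+ 2).
  rewrite (_ : (fun _ => _) =
    (cst 7 - cst 3 * id) * id * ((cst 1 - id) * (cst 1 - id)))//.
  by move=> y; do ![exact: cvg_cst|exact: cvg_id|apply: cvgM|apply: cvgB].
have cw : continuous (fun y : R => (1 - y) * (12 - y)).
  by move=> y; do ![exact: cvg_cst|exact: cvg_id|apply: cvgM|apply: cvgB].
have ch : continuous (fun y : R => 3 - 2 * y).
  by move=> y; do ![exact: cvg_cst|exact: cvg_id|apply: cvgM|apply: cvgB].
have ip : mu.-integrable D (EFin \o p).
  apply: integrable_nonneg => //.
    exact: (measurable_weighted _ (fun y => (7 - 3 * y) * y * (1 - y) ^+ 2)).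
  by move=> z Dz; apply: mulr_ge0; [exact: wp0|exact: sqr_ge0].
have iw : mu.-integrable D (EFin \o w).
  apply: integrable_nonneg => //.
    exact: (measurable_weighted _ (fun y => (1 - y) * (12 - y))).
  by move=> z Dz; apply: mulr_ge0; [exact: ww0|exact: sqr_ge0].
pose q y := (3 - 2 * y) * Phi y.
have iq : mu.-integrable D (EFin \o q).
  have -> : q = (fun y => Phi y * (3 - 2 * y)) by apply/funext => y; rewrite /q mulrC.
  apply: (integrable_mul_bounded _ _ _ 3) => //.
  by apply: measurable_funTS; exact: continuous_measurable_fun.
pose e y := 300 * p y - 301 * w y.
have ie : mu.-integrable D (EFin \o e).
  have := integrable_addE D _ _ mD (integrable_scaleE D 300 _ mD ip)
    (integrable_scaleE D (- 301) _ mD iw).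
  by congr (_.-integrable _ (EFin \o _)); apply/funext => y; rewrite /e mulNr.
have [] := primitive01 _ iq; set F := fun x => _ => FA F0 F1 F0c F1c.
have [] := primitive01 _ ie; set E := fun x => _ => EA E0 E1 E0c E1c.
(* Lebesgue points of the zero extension of Phi: almost every point, and exactly where the
   fundamental theorem for weak derivatives can be anchored. *)
pose good (z : R) := lebesgue_pt (Phi \_ `]0, 1[) z.
have aeg : {ae mu, forall z, good z}.
  apply: lebesgue_differentiation.
  exact: (integrable_locally_restrict (A := [set` `]0, 1[])).
have eE : \int[mu]_(z in `]0, 1[) e z = 300 * \int[mu]_(y in D) p y -
    301 * \int[mu]_(y in D) w y.
  rewrite /e RintegralB//; first by rewrite !RintegralZl.
  - exact: integrable_scaleE.
  - exact: integrable_scaleE.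
(* With P, W, L the integrals of [p], [w], [q], the conclusion reads 300 P - 301 W + 1000 L^2 >= 0,
   which is 300 times the claim. *)
have main := boundary_limit good E F _ _ (50 * 1000) aeg E0c F0c E1c F1c.
suff h : forall s t, good s -> good t -> 0 < s <= 1 / 100 -> 99 / 100 <= t < 1 ->
    E s - 50 * 1000 * F s ^+ 2 <=
      E t + (zp_eval R cert_d t + 100 * 1000 * (1 - t)) * F t ^+ 2.
  have := main h; rewrite eE -[\int[mu]_(z in _) q z]/(\int[mu]_(z in D) q z).
  rewrite -/(Rintegral mu D p) -/(Rintegral mu D w) -/(Rintegral mu D q).
  by move: (Rintegral mu D p) (Rintegral mu D w) (Rintegral mu D q) => P W L; lra.
move=> s t gs gt /andP[s0 s1] /andP[t0 t1].
have st : s < t by lra.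
have gi : mu.-integrable [set` `[s, t]] (EFin \o g).
  apply: (locally_integrable_compact D).
  - by have [] := wd.
  - exact: segment_compact.
  - move=> z; rewrite /D /= !in_itv /= => /andP[sz zt].
    by rewrite (lt_le_trans s0)// (le_lt_trans zt).
(* The absolutely continuous representative of Phi on [s, t], anchored at the Lebesgue point s; it
   agrees with Phi at every Lebesgue point of the interval. *)
pose u x := Phi s + \int[mu]_(z in `[s, x]) g z.
have us : u s = Phi s by rewrite /u set_itv1 Rintegral_set1 addr0.
have ug : abs_cont R s t u g by split => // x _; rewrite us.
have uPhi z : good z -> s <= z <= t -> u z = Phi z.
  move=> gz /andP[]; rewrite le_eqVlt => /predU1P[<- //|sz zt].
  rewrite /u (weak_derivative_FTC 0 1 s z Phi g)//; first by ring.
  exact: le_lt_trans t1.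
have aeu : {ae mu, forall z, s <= z <= t -> u z = Phi z}.
  exact: (@filterS _ _ (ae_filter_ringOfSetsType mu) _ _ _ aeg).
have itv x : s <= x <= t -> x \in `]0, 1[.
  by move=> /andP[sx xt]; rewrite in_itv /= (lt_le_trans s0)// (le_lt_trans xt).
have sub v k : abs_cont R 0 1 v k -> abs_cont R s t v k.
  by apply: abs_cont_sub; [exact: ltW|exact: ltW|exact: ltW].
have [Fq Ee] := (sub _ _ FA, sub _ _ EA).
have eqE z : s <= z <= t -> (e \_ `]0, 1[) z = e z.
  by move=> /itv zD; rewrite patchE mem_setE zD.
have ei : mu.-integrable [set` `[s, t]] (EFin \o e).
  by apply: integrableS ie => // z; rewrite /D /= in_itv /= => /itv.
have := energy_storage_ge0 s t Phi g _ u F (ltW s0) (ltW st) (ltW t1) ug aeu Fq.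
have qE z : s <= z <= t -> (q \_ `]0, 1[) z = (3 - 2 * z) * Phi z.
  by move=> /itv zD; rewrite patchE mem_setE zD.
move=> /(_ qE ei); rewrite -[\int[_]_(z in _) _]/(\int[mu]_(z in `[s, t]) e z).
have -> : \int[mu]_(z in `[s, t]) e z = E t - E s.
  rewrite (abs_contB _ _ _ _ _ _ Ee)//; last exact: ltW.
  by apply: eq_Rintegral => z; rewrite inE /= in_itv /= => /eqE.
(* These two bounds eliminate u s and u t, over which there is no control as s and t approach the
   endpoints. *)
have := cert_right t (u t) (F t); have := cert_left s (u s) (F s).
rewrite /storage (ltW s0) s1 t0 (ltW t1) => /(_ isT) hs /(_ isT) ht.
move: (zp_eval R cert_a s * _ + _ + _) (zp_eval R cert_a t * _ + _ + _)
  hs ht => Ss St hs ht h.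
lra.
Qed.
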